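(* Let $X\subseteq\mathbb{R}$ be a set constructed as described in the context, from a family of intervals $\{[a_n,b_n]\colon n<\omega\}$ and sets $A_n$ ($n<\omega$). Then $X$ is plastic.
   Context: Plasticity: for a metric space $(X,d)$, a map $f\colon X\to X$ is non-expansive if $d(f(x),f(y))\leq d(x,y)$ for all $x,y\in X$. A metric space $X$ is plastic if every non-expansive bijection $f\colon X\to X$ is an isometry; a subset of a metric space is plastic if it is plastic as a subspace. $\mathbb{R}$ carries the usual metric. Construction of $X$: let $\mathcal{R}=\{[a_n,b_n]\colon n<\omega\}$ be a pairwise disjoint family of closed intervals of $\mathbb{R}$ (with $a_n<b_n$) such that for every $m,n<\omega$: (1) $a_n,b_n\in\mathbb{Q}$; (2) $2(b_{n+1}-a_{n+1})<b_n-a_n$; (3) if $b_m<a_n$, then $a_n-b_m>b_0-a_0$; (4) $a_0<a_1$; (5) for every $x\in\mathbb{R}$ there exist $k$ and $l$ such that $b_k<x<a_l$. It follows that for each $n$ there is a unique $m$ (the index of the next interval to the right) such that $x<y$ for all $x\in[a_n,b_n]$, $y\in[a_m,b_m]$, and $(b_n,a_m)\cap\bigcup\mathcal{R}=\emptyset$. For each $n$, with this $m$, let $A_n\subseteq(b_n,a_m)$ be a set such that $|A_n\cap U|=\omega_1$ for every non-empty open $U\subseteq(b_n,a_m)$. Define $$X=\bigcup_{n<\omega}\big((\mathbb{Q}\cap[a_n,b_n])\cup A_n\big).$$ *)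

(* Defs.v *)
From HB Require Import structures.
From mathcomp Require Import all_boot all_order all_algebra.
From mathcomp Require Import all_classical all_reals all_analysis.
From mathcomp Require Import wochoice.

Set Implicit Arguments.
Unset Strict Implicit.
Unset Printing Implicit Defensive.

Import Order.TTheory GRing.Theory Num.Theory.
Import numFieldNormedType.Exports.

Local Open Scope classical_set_scope.
Local Open Scope ring_scope.

(* The library makes [set_type A] a pseudometric space, with balls induced from
   the ambient space; this adds the matching restricted distance. *)
Section subspace_metric.
Context {R : realType} {M : metricType R} (A : set M).

Definition subspace_mdist (x y : set_type A) : R :=
  mdist (set_val x) (set_val y).

Lemma subspace_mdist_ge0 x y : 0 <= subspace_mdist x y.
Proof. exact: mdist_ge0. Qed.

Lemma subspace_mdist_positivity x y : subspace_mdist x y = 0 -> x = y.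
Proof. by move=> xy; apply: val_inj; exact: mdist_positivity xy. Qed.

Lemma subspace_ballEmdist (x : set_type A) (d : R) :
  ball x d = [set y | subspace_mdist x y < d].
Proof.
transitivity (@set_val _ A @^-1` ball (set_val x) d) => //.
by rewrite ballEmdist.
Qed.

HB.instance Definition _ := PseudoMetric_isMetric.Build R (set_type A)
  subspace_mdist_ge0 subspace_mdist_positivity subspace_ballEmdist.

End subspace_metric.

Definition nonexpansive (R : realType) (M : metricType R) (f : M -> M) :=
  forall x y, mdist (f x) (f y) <= mdist x y.

Definition isometry (R : realType) (M : metricType R) (f : M -> M) :=
  forall x y, mdist (f x) (f y) = mdist x y.

Definition plastic (R : realType) (M : metricType R) :=
  forall f : M -> M, bijective f -> nonexpansive f -> isometry f.

Definition plastic_subset (R : realType) (M : metricType R) (A : set M) :=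
  plastic (set_type A : metricType R).

(* omega_1 is the least uncountable ordinal: up to isomorphism, the unique
   uncountable well-order all of whose proper initial segments are countable. *)
Definition is_omega1 (W : Type) (le : rel W) :=
  [/\ well_order le,
      ~ countable [set: W] &
      forall w, countable [set v | le v w /\ v <> w]].

Definition has_card_omega1 (T : Type) (S : set T) :=
  exists (W : Type) (le : rel W), is_omega1 le /\ (S #= [set: W])%card.

Section construction.
Context {R : realType}.
Implicit Types (a b : nat -> R) (A : nat -> set R).

Definition interval_family a b := \bigcup_n `[a n, b n]%classic.

Definition next_interval a b (n m : nat) :=
  (forall x y, x \in `[a n, b n] -> y \in `[a m, b m] -> x < y) /\
  `]b n, a m[%classic `&` interval_family a b = set0.

Definition constructed_set a b A : set R :=
  \bigcup_n ((rational (R := R) `&` `[a n, b n]%classic) `|` A n).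

End construction.

(* Main.v *)
(* The points of X in the intervals I_n = [a_n, b_n] are rational, whereas X is
   uncountable in every open subset of a gap. A non-expansive bijection f of X
   takes the values a_n and b_n, so over some stretch ]u, v[ with
   v - u >= b_n - a_n it crosses I_n, staying strictly inside. As f is
   injective, X is countable on ]u, v[, hence ]u, v[ misses the gaps and lies in
   a single I_m, with m <= n because the lengths decrease. By induction f
   permutes the endpoints of I_m for m < n, hence maps I_m to itself, which
   leaves only m = n: f permutes the endpoints of I_n. A flip of I_n would
   bring b_n too far from the intervals to its right, so f fixes all endpoints;
   as these are unbounded in both directions, f is the identity. *)
Require Import Defs.
From mathcomp Require Import all_boot all_order all_algebra.
From mathcomp Require Import all_classical all_reals all_analysis.
From mathcomp Require Import lra.
Import Order.TTheory GRing.Theory Num.Theory.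
Import numFieldNormedType.Exports.
Local Open Scope classical_set_scope.
Local Open Scope ring_scope.

(** * Non-expansive maps on a subset of the line *)

Definition nonexpansive_on {R : realType} (X : set R) (g : R -> R) :=
  forall x y, X x -> X y -> `|g y - g x| <= `|y - x|.

Lemma nonexpansive_on_le {R : realType} {X : set R} {g : R -> R} {x y : R} :
  nonexpansive_on X g -> X x -> X y -> x <= y ->
  g x - (y - x) <= g y <= g x + (y - x).
Proof.
move=> gX Xx Xy xy; have := gX _ _ Xx Xy.
rewrite [X in _ <= X]ger0_norm ?subr_ge0// ler_norml => /andP[? ?].
by apply/andP; split; lra.
Qed.

(* Since [g] need not extend to all of [R], the last point below [c] and the
   first point above [d] are replaced by a supremum and an infimum. *)
Lemma nonexpansive_crossing {R : realType} {X : set R} {g : R -> R}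
    {c d p q : R} :
  nonexpansive_on X g -> X p -> X q -> c < d -> p < q -> g p <= c -> d <= g q ->
  exists u v, [/\ d - c <= v - u,
    forall x, X x -> u < x < v -> c < g x < d,
    X u -> g u <= c &
    X v -> d <= g v].
Proof.
move=> gX Xp Xq cd pq gp gq.
pose S := [set x | [/\ X x, x <= q & g x <= c]].
have Sp : S p by split=> //; exact: ltW.
have ubS : has_ubound S by exists q => x [].
have supS : has_sup S by split=> //; exists p.
pose u := sup S.
have leu x : S x -> x <= u by move=> Sx; exact: ub_le_sup.
have uq : u <= q by apply: ge_sup; [exists p|move=> x []].
(* Taking only points right of [u] puts [T] beyond [S]; as [g] is non-expansive, points of [S] and
   [T] are then at least [d - c] apart. *)
pose T := [set x | [/\ X x, u <= x & d <= g x]].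
have Tq : T q by [].
have lbT : has_lbound T by exists u => x [].
have infT : has_inf T by split=> //; exists q.
pose v := inf T.
have gev x : T x -> v <= x by move=> Tx; exact: ge_inf.
exists u, v; split.
- have : u + (d - c) <= v; last by move=> ?; lra.
  apply: lb_le_inf; first by exists q.
  move=> t [Xt ut gt].
  suff : u <= t - (d - c) by move=> ?; lra.
  apply: ge_sup; first by exists p.
  move=> s Ss; have := leu _ Ss; case: Ss => Xs _ gs su.
  have /andP[_ ?] := nonexpansive_on_le gX Xs Xt (le_trans su ut).
  by lra.
- move=> x Xx /andP[ux xv].
  have xq : x <= q by apply: le_trans (ltW xv) (gev _ Tq).
  apply/andP; split.
    rewrite ltNge; apply/negP => gx.
    by have := leu x (And3 Xx xq gx); lra.
  rewrite ltNge; apply/negP => gx.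
  by have := gev x (And3 Xx (ltW ux) gx); lra.
- move=> Xu; apply/ler_addgt0Pr => e e0.
  have [s Ss se] := sup_adherent e0 supS; have su := leu _ Ss.
  rewrite -/u in se; case: Ss => Xs _ gs.
  have /andP[_ ?] := nonexpansive_on_le gX Xs Xu su.
  by lra.
- move=> Xv; apply/ler_addgt0Pr => e e0.
  have [s Ts se] := inf_adherent e0 infT; have su := gev _ Ts.
  rewrite -/v in se; case: Ts => Xs _ gs.
  have /andP[_ ?] := nonexpansive_on_le gX Xv Xs su.
  by lra.
Qed.

Lemma has_card_omega1_uncountable (T : Type) (S : set T) :
  has_card_omega1 S -> ~ countable S.
Proof. by move=> [W [le [[_ Wunc _]]]] /eq_countable ->. Qed.

Lemma countable_rational (R : realType) : countable (rational (R := R)).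
Proof. exact: sub_countable (card_image_le _ _) (countableP _). Qed.

(** * Geometry of the intervals and the gaps between them *)

Section separated_intervals.
Context {R : realType} {a b : nat -> R}.
Hypothesis hab : forall n, a n < b n.
Hypothesis hdisj : trivIset setT (fun n => `[a n, b n]%classic).
Hypothesis h2 : forall n, 2 * (b n.+1 - a n.+1) < b n - a n.
Hypothesis h3 : forall m n, b m < a n -> a n - b m > b 0%N - a 0%N.
Hypothesis h5 : forall x : R, exists k l, b k < x < a l.

Local Notation J := (interval_family a b).

Lemma interval_family_mem n x : a n <= x <= b n -> J x.
Proof. by move=> nx; exists n => //=; rewrite in_itv. Qed.

Lemma interval_uniq n m x : a n <= x <= b n -> a m <= x <= b m -> n = m.
Proof.
move=> nx mx; apply: hdisj => //.
by exists x; split; rewrite /= in_itv.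
Qed.

(** If [a n <= b m], then [y] or [b m] would lie in both intervals, against disjointness. *)
Lemma interval_sep m n x y :
  a m <= x <= b m -> a n <= y <= b n -> x < y -> m <> n -> b m < a n.
Proof.
move=> /andP[mx xm] /andP[ny yn] xy mn; rewrite ltNge; apply/negP => nm.
have [bnm|bnm] := leP (b n) (b m).
  have [amy|amy] := leP (a m) y.
    by apply: mn; apply: (interval_uniq _ _ y); lra.
  by lra.
have bm := hab m.
by apply: mn; apply: (interval_uniq _ _ (b m)); lra.
Qed.

Lemma interval_length_le m n :
  b n - a n <= b m - a m -> (m <= n)%N.
Proof.
have dec k : b k.+1 - a k.+1 < b k - a k by have := h2 k; have := hab k.+1; lra.
have lt i k : (i < k)%N -> b k - a k < b i - a i.
  elim: k => // k IH; rewrite ltnS leq_eqVlt => /predU1P[->//|/IH].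
  exact: lt_trans.
by move=> nm; rewrite leqNgt; apply/negP => /lt; lra.
Qed.

Lemma gap_around x : ~ J x ->
  exists k m, next_interval a b k m /\ b k < x < a m.
Proof.
move=> Jx; have L0 : 0 < b 0%N - a 0%N by rewrite subr_gt0.
have [k0 [l0 /andP[k0x xl0]]] := h5 x.
have side j : b j < x \/ x < a j.
  have [xj|] := leP (a j) x; last by right.
  have [xbj|] := leP x (b j); last by left.
  by case: Jx; apply: (interval_family_mem j); rewrite xj.
(* By [h3], distinct right endpoints differ by more than [b 0 - a 0], so one that is within this
   distance of the supremum is the largest. *)
have [k bkx kmax] : exists2 k, b k < x & forall j, b j < x -> b j <= b k.
  pose S := [set b j | j in [set j | b j < x]].
  have S0 : S !=set0 by exists (b k0), k0.
  have ubS : has_ubound S by exists x => _ [j /= /ltW bj <-].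
  have [_ [k /= bkx <-] kS] := sup_adherent L0 (conj S0 ubS).
  exists k => // j bjx; rewrite leNgt; apply/negP => kj.
  have bjS : b j <= sup S by apply: ub_le_sup => //; exists j.
  have /h3 : b k < a j.
    apply: (interval_sep _ _ (b k) (b j)) => //.
    - by have := hab k; lra.
    - by have := hab j; lra.
    - by move=> e; move: kj; rewrite e ltxx.
  by have := hab j; lra.
have [m xam mmin] : exists2 m, x < a m & forall j, x < a j -> a m <= a j.
  pose S := [set a j | j in [set j | x < a j]].
  have S0 : S !=set0 by exists (a l0), l0.
  have lbS : has_lbound S by exists x => _ [j /= /ltW aj <-].
  have [_ [m /= xam <-] mS] := inf_adherent L0 (conj S0 lbS).
  exists m => // j xaj; rewrite leNgt; apply/negP => jm.
  have ajS : inf S <= a j by apply: ge_inf => //; exists j.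
  have /h3 : b j < a m.
    apply: (interval_sep _ _ (a j) (a m)) => //.
    - by have := hab j; lra.
    - by have := hab m; lra.
    - by move=> e; move: jm; rewrite e ltxx.
  by have := hab j; lra.
exists k, m; split; last by rewrite bkx.
split.
  by move=> y z; rewrite !in_itv /=; lra.
rewrite -subset0 => z [/=]; rewrite in_itv /= => kzm [j _ /=].
rewrite in_itv /= => jz; have [/kmax|/mmin] := side j; by lra.
Qed.

Lemma interval_family_right_gap n y :
  b n < y < b n + (b 0%N - a 0%N) -> ~ J y.
Proof.
move=> ny [j _ /=]; rewrite in_itv /= => jy.
have /h3 : b n < a j; last by lra.
have ab := hab n.
apply: (interval_sep _ _ (b n) y) => //; first by lra.
- by lra.
- by move=> e; subst j; lra.
Qed.

Lemma interval_family_left_gap n y :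
  a n - (b 0%N - a 0%N) < y < a n -> ~ J y.
Proof.
move=> ny [j _ /=]; rewrite in_itv /= => jy.
have /h3 : b j < a n; last by lra.
have ab := hab n.
apply: (interval_sep _ _ y (a n)) => //; first by lra.
- by lra.
- by move=> e; subst j; lra.
Qed.

(** The hypotheses on [A n] constrain it only once a next interval is given. *)
Lemma next_interval_exists n : exists m, next_interval a b n m.
Proof.
have L0 := hab 0%N.
pose y := b n + (b 0%N - a 0%N) / 2.
have [|k [m [km kym]]] := gap_around y.
  by apply: (interval_family_right_gap n); rewrite /y; lra.
suff -> : n = k by exists m.
(* If [b k < b n], then [b n] lies inside the gap around [y]; if [b n < b k], then [h3] pushes [a k]
   beyond [y]. *)
apply: contrapT => nk; have abn := hab n; have abk := hab k.
have [kn|kn] := leP (b k) (b n).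
  have : ~ J (b n).
    move=> Jn; have [_] := km; rewrite -subset0 => /(_ (b n)).
    apply; split=> //=.
    rewrite in_itv /=; have : b k <> b n.
      by move=> e; apply: nk; apply: (interval_uniq _ _ (b n)); lra.
    by move=> /eqP; rewrite neq_lt /y in kym *; lra.
  by apply; apply: (interval_family_mem n); lra.
have /h3 : b n < a k by apply: (interval_sep _ _ (b n) (b k)) => //; lra.
by rewrite /y in kym; lra.
Qed.

(** If the interval holding the midpoint ended inside []u, v[], a point just past its end would
    still be in []u, v[] but, by [h3], in no interval. *)
Lemma subset_one_interval u v : u < v -> (forall y, u < y < v -> J y) ->
  exists m, a m <= u /\ v <= b m.
Proof.
move=> uv uvJ; have L0 := hab 0%N.
have [|m _ /=] := uvJ ((u + v) / 2); first by lra.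
rewrite in_itv /= => mid; exists m; split.
- rewrite leNgt; apply/negP => um.
  pose y := Num.max ((u + a m) / 2) (a m - (b 0%N - a 0%N) / 2).
  have [y1 y2 y3] : [/\ u < y, a m - (b 0%N - a 0%N) < y & y < a m].
    by rewrite /y; case: (leP ((u + a m) / 2)) => ?; split; lra.
  by apply: (interval_family_left_gap m y); [lra|apply: uvJ; lra].
- rewrite leNgt; apply/negP => mv.
  pose y := Num.min ((v + b m) / 2) (b m + (b 0%N - a 0%N) / 2).
  have [y1 y2 y3] : [/\ y < v, y < b m + (b 0%N - a 0%N) & b m < y].
    by rewrite /y; case: (leP ((v + b m) / 2)) => ?; split; lra.
  by apply: (interval_family_right_gap m y); [lra|apply: uvJ; lra].
Qed.

(** * Rationality and cardinality in the constructed set *)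

Context {A : nat -> set R}.
Hypothesis h1 : forall n, rational (a n) /\ rational (b n).
Hypothesis hsub : forall n m, next_interval a b n m -> A n `<=` `]b n, a m[.
Hypothesis hcard : forall n m, next_interval a b n m ->
  forall U : set R, open U -> U !=set0 -> U `<=` `]b n, a m[ ->
    has_card_omega1 (A n `&` U).

Local Notation X := (constructed_set a b A).

Lemma constructed_set_rational n x : rational x -> a n <= x <= b n -> X x.
Proof. by move=> qx nx; exists n => //; left; split; rewrite /= ?in_itv. Qed.

Lemma constructed_set_left n : X (a n).
Proof.
have ab := hab n; apply: (constructed_set_rational n); first by have [] := h1 n.
by lra.
Qed.

Lemma constructed_set_right n : X (b n).
Proof.
have ab := hab n; apply: (constructed_set_rational n); first by have [] := h1 n.
by lra.
Qed.

(** A point of some [A k] lies in a gap, which misses every interval. *)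
Lemma rational_constructed_set n x : X x -> a n <= x <= b n -> rational x.
Proof.
move=> [k _ [[]//|Akx]] nx; have [m km] := next_interval_exists k.
have [_] := km; rewrite -subset0 => /(_ x) [].
by split; [exact: hsub km _ Akx|exact: (interval_family_mem n)].
Qed.

Lemma countable_constructed_set_covered u v y :
  countable (X `&` `]u, v[%classic) -> u < y < v -> J y.
Proof.
move=> cX uyv; apply: contrapT => /gap_around[k [m [km kym]]].
have /has_card_omega1_uncountable : has_card_omega1
    (A k `&` (`]u, v[%classic `&` `]b k, a m[%classic)).
  apply: (hcard _ _ km); last by apply: subIsetr.
    by apply: openI; exact: itv_open.
  by exists y; split; rewrite /= in_itv.
apply; apply: sub_countable cX; apply: subset_card_le => x [Akx [ux _]].
by split => //; exists k => //; right.
Qed.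

(** * Rigidity of non-expansive bijections *)

Section nonexpansive_bijection.
Context {g : R -> R}.
Hypothesis gX : set_fun X X g.
Hypothesis ginj : set_inj X g.
Hypothesis gsurj : set_surj X X g.
Hypothesis gne : nonexpansive_on X g.

(* An injection of [X `&` `]u, v[] into the rationals forces this set to be
   countable, so that [`]u, v[] meets no gap. *)
Lemma crossing_in_interval n u v : b n - a n <= v - u ->
  (forall x, X x -> u < x < v -> a n < g x < b n) ->
  exists m, [/\ (m <= n)%N, a m <= u & v <= b m].
Proof.
move=> uv guv; have ab := hab n.
have cX : countable (X `&` `]u, v[%classic).
  have inj : {in X `&` `]u, v[%classic &, injective g}.
    by move=> x y /set_mem[Xx _] /set_mem[Xy _]; apply: ginj; exact/mem_set.
  rewrite -(eq_countable (inj_card_eq inj)).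
  apply: sub_countable (countable_rational R).
  apply: subset_card_le => ? [x [Xx]]; rewrite /= in_itv /= => uxv <-.
  apply: (rational_constructed_set n); first exact: gX.
  by have := guv _ Xx uxv; lra.
have [||m [mu vm]] := subset_one_interval u v; first by lra.
  by move=> y; exact: countable_constructed_set_covered.
by exists m; split=> //; apply: interval_length_le; lra.
Qed.

Lemma endpoints_crossing n : exists u v, [/\ b n - a n <= v - u,
  forall x, X x -> u < x < v -> a n < g x < b n &
  X u -> X v -> (g u <= a n /\ b n <= g v) \/ (b n <= g u /\ g v <= a n)].
Proof.
have ab := hab n.
have [p Xp gp] := gsurj _ (constructed_set_left n).
have [q Xq gq] := gsurj _ (constructed_set_right n).
have [pq|qp|pq] := ltgtP p q; last by move: gp; rewrite pq gq; lra.
- have [||u [v [uv guv gu gv]]] := nonexpansive_crossing gne Xp Xq ab pq.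
  + by rewrite gp.
  + by rewrite gq.
  by exists u, v; split=> // Xu Xv; left; split; [exact: gu|exact: gv].
(* When the preimages come in reverse order, [- g] makes an upward crossing from [- b n] to
   [- a n]. *)
- pose h x := - g x.
  have hne : nonexpansive_on X h.
    by move=> x y Xx Xy; rewrite /h -opprD normrN; exact: gne.
  have ab' : - b n < - a n by rewrite ltrN2.
  have [||u [v [uv guv gu gv]]] := nonexpansive_crossing hne Xq Xp ab' qp.
  + by rewrite /h gq.
  + by rewrite /h gp.
  exists u, v; split; first by lra.
  + by move=> x Xx /(guv _ Xx); rewrite /h; lra.
  + by move=> /gu + /gv; rewrite /h => ? ?; right; split; lra.
Qed.

Lemma endpoints_permuted n :
  (g (a n) = a n /\ g (b n) = b n) \/ (g (a n) = b n /\ g (b n) = a n).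
Proof.
elim/ltn_ind: n => n IH; have ab := hab n.
have [u [v [uv guv gend]]] := endpoints_crossing n.
have [m [mn mu vm]] := crossing_in_interval _ _ _ uv guv.
move: mn; rewrite leq_eqVlt => /predU1P[mn|mn].
  (* A stretch of length at least [b n - a n] inside the interval is all of it, and
     non-expansiveness turns the two inequalities at the ends into equalities. *)
  subst m; have [eu ev] : u = a n /\ v = b n by split; lra.
  subst u v; have Xa := constructed_set_left n.
  have Xb := constructed_set_right n.
  have /andP[? ?] := nonexpansive_on_le gne Xa Xb (ltW ab).
  by have [[? ?]|[? ?]] := gend Xa Xb; [left|right]; split; lra.
have ltuv : u < v by lra.
(* A rational is chosen because it is sure to be in [X]. Its distances to the permuted endpoints of
   interval [m] keep its image in that interval, while the crossing puts it in interval [n]. *)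
have [r] := rat_in_itvoo ltuv; rewrite in_itv /= => uqv.
have Xq : X (ratr r) by apply: (constructed_set_rational m); [exists r|lra].
have gq := guv _ Xq uqv.
have aq : a m <= ratr r by lra.
have qb : ratr r <= b m by lra.
have := nonexpansive_on_le gne (constructed_set_left m) Xq aq.
have := nonexpansive_on_le gne Xq (constructed_set_right m) qb.
have : n <> m by move=> e; rewrite e ltnn in mn.
move=> nm ? ?; case: nm; apply: (interval_uniq _ _ (g (ratr r))); first by lra.
by have [[? ?]|[? ?]] := IH _ mn; lra.
Qed.

Lemma endpoints_fixed n : g (a n) = a n /\ g (b n) = b n.
Proof.
have [//|[gan gbn]] := endpoints_permuted n; exfalso.
(* For an interval [m] further right, [g (a m)] is at least [a m], hence farther from [a n] than
   [a m] is from [b n]. *)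
have [_ [m /andP[_ bnm]]] := h5 (b n).
have := nonexpansive_on_le gne (constructed_set_right n)
  (constructed_set_left m) (ltW bnm).
have := hab n; have := hab m.
by have [[? ?]|[? ?]] := endpoints_permuted m; lra.
Qed.

(** A fixed point left of [x] gives [g x <= x], and one right of [x] gives [x <= g x]. *)
Lemma nonexpansive_bijection_id x : X x -> g x = x.
Proof.
move=> Xx; have [k [l /andP[kx xl]]] := h5 x.
have := nonexpansive_on_le gne (constructed_set_right k) Xx (ltW kx).
have := nonexpansive_on_le gne Xx (constructed_set_left l) (ltW xl).
have [_ ->] := endpoints_fixed k; have [-> _] := endpoints_fixed l.
by lra.
Qed.

End nonexpansive_bijection.

End separated_intervals.

Theorem theorem5 (R : realType) (a b : nat -> R) (A : nat -> set R)
  (hab : forall n, a n < b n)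
  (hdisj : trivIset setT (fun n => `[a n, b n]%classic))
  (h1 : forall n, rational (a n) /\ rational (b n))
  (h2 : forall n, 2 * (b n.+1 - a n.+1) < b n - a n)
  (h3 : forall m n, b m < a n -> a n - b m > b 0%N - a 0%N)
  (h4 : a 0%N < a 1%N)
  (h5 : forall x : R, exists k l, b k < x < a l)
  (hsub : forall n m, next_interval a b n m -> A n `<=` `]b n, a m[)
  (hcard : forall n m, next_interval a b n m ->
    forall U : set R, open U -> U !=set0 -> U `<=` `]b n, a m[ ->
      has_card_omega1 (A n `&` U)) :
  plastic_subset (constructed_set a b A : set R^o).
Proof.
move=> f [f' fK f'K] fne.
set X := constructed_set a b A in f f' fK f'K fne *.
(* The value 0 outside [X] is arbitrary: what is assumed and proved of [g] concerns points of [X]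
   only. *)
pose g (x : R) : R := if pselect (X x) is left Xx
  then \val (f (exist _ x (mem_set Xx))) else 0.
have gE (x : set_type X) : g (\val x) = \val (f x).
  rewrite /g; case: pselect => [Xx|]; last by case; exact: set_valP.
  by congr (\val (f _)); exact: val_inj.
have lift x : X x -> exists y : set_type X, \val y = x.
  by move=> Xx; exists (exist _ x (mem_set Xx)).
have gid : forall x, X x -> g x = x.
  apply: (nonexpansive_bijection_id hab hdisj h2 h3 h5 h1 hsub hcard).
  - by move=> _ /lift[x <-]; rewrite gE; exact: set_valP.
  - move=> x y /set_mem/lift[{}x <-] /set_mem/lift[{}y <-].
    by rewrite !gE => /val_inj/(can_inj fK) ->.
  - move=> _ /lift[y <-]; exists (\val (f' y)); first exact: set_valP.
    by rewrite gE f'K.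
  - by move=> _ _ /lift[x <-] /lift[y <-]; rewrite !gE; exact: fne.
have fid x : f x = x by apply: val_inj; rewrite -gE gid //; exact: set_valP.
by move=> x y; rewrite !fid.
Qed.
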